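(* Assume that $|\chi|=s<\infty$ and that $\chi^{-1}(a)$ is a primitive $s$-th root of unity. Let $\sigma,\lambda\in\widehat{G}$ and $\alpha,\beta\in k$. Then, as $H$-modules, $$V(\sigma,\alpha)\otimes V(\lambda,\beta)\cong\bigoplus_{t=0}^{s-1}V(\chi^t\sigma\lambda,\ \alpha\lambda(a)^s+\beta).$$
   Context: $k$ is a field, $G$ a group, $\widehat{G}$ the group of characters $G\to k^{\times}$, $\chi\in\widehat{G}$ of order $|\chi|$, and $a\in Z(G)$ with $\chi(a)\neq 1$. $H=kG(\chi^{-1},a,0)$ is the Hopf algebra generated as an algebra by $G$ and $x$ with relations $xg=\chi^{-1}(g)gx$ ($g\in G$), having $k$-basis $\{gx^i\mid g\in G,i\geq 0\}$, with $\Delta(x)=x\otimes a+1\otimes x$, $\varepsilon(x)=0$, $S(x)=-xa^{-1}$, and each $g\in G$ group-like. Tensor products of $H$-modules are over $k$, with $H$ acting through $\Delta$. If $|\chi|=s<\infty$, $\lambda\in\widehat{G}$ and $\gamma\in k$, then $V(\lambda,\gamma)$ is the $H$-module with $k$-basis $m_0,\dots,m_{s-1}$ and action $g\cdot m_i=\chi^i(g)\lambda(g)m_i$; $x\cdot m_i=m_{i+1}$ for $0\leq i\leq s-2$; $x\cdot m_{s-1}=\gamma m_0$. *)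

(* Defs.v *)
From HB Require Import structures.
From mathcomp Require Import all_boot all_order all_algebra.
From mathcomp Require Import finmap.
From mathcomp.multinomials Require Import monalg.

Set Implicit Arguments.
Unset Strict Implicit.
Unset Printing Implicit Defensive.

Import GRing.Theory.
Local Open Scope fset_scope.
Local Open Scope ring_scope.

Lemma linear_scale (k : fieldType) (U V : lmodType k) (f : U -> V) :
  linear f -> forall c u, f (c *: u) = c *: f u.
Proof.
move=> fl c u; pose F := HB.pack_for {linear U -> V} f
  (GRing.isLinear.Build k _ _ _ f fl).
exact: (linearZZ F).
Qed.

HB.lock Definition single (k : fieldType) (B : choiceType) (b : B) :
  {malg k[B]} := << b >>.

(* The linear extension of [f] to the vector space with basis [B]. *)
HB.lock Definition lext (k : fieldType) (B : choiceType) (U : lmodType k)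
    (f : B -> U) (p : {malg k[B]}) : U :=
  \sum_(b <- msupp p) p@_b *: f b.

Section LinearExtension.
Variables (k : fieldType) (B : choiceType).

Section Defs.
Variables (U : lmodType k) (f : B -> U).

Lemma lextEw (d : {fset B}) p :
  msupp p `<=` d -> lext f p = \sum_(b <- d) p@_b *: f b.
Proof.
rewrite lext.unlock => le; rewrite [LHS](big_fset_incl _ le) => //= b bd /mcoeff_outdom ->.
by rewrite scale0r.
Qed.

Lemma lext_is_linear : linear (lext f).
Proof.
move=> c p q; pose d := msupp p `|` msupp q.
have sp : msupp p `<=` d by rewrite fsubsetUl.
have sq : msupp q `<=` d by rewrite fsubsetUr.
have sr : msupp (c *: p + q) `<=` d.
  apply: fsubset_trans (msuppD_le _ _) _.
  by rewrite fsetSU // msuppZ_le.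
rewrite (lextEw sr) (lextEw sp) (lextEw sq) scaler_sumr -big_split /=.
by apply: eq_bigr => b _; rewrite mcoeffD mcoeffZ scalerDl scalerA.
Qed.

HB.instance Definition _ :=
  GRing.isLinear.Build k {malg k[B]} U *:%R (lext f) lext_is_linear.

Lemma lextU b : lext f (single k b) = f b.
Proof. by rewrite single.unlock (lextEw msuppU_le) big_seq_fset1 mcoeffUU scale1r. Qed.

End Defs.

Lemma lext_linear_fun (U : lmodType k) (h f g : B -> U) c p :
  (forall b, h b = c *: f b + g b) -> lext h p = c *: lext f p + lext g p.
Proof.
move=> E; rewrite lext.unlock scaler_sumr -big_split /=; apply: eq_bigr => b _.
by rewrite E scalerDr !scalerA mulrC.
Qed.

Lemma malg_lin_ext (U : lmodType k) (F1 F2 : {malg k[B]} -> U) :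
    linear F1 -> linear F2 -> (forall b, F1 (single k b) = F2 (single k b)) -> F1 =1 F2.
Proof.
move=> l1 l2 E p.
pose L1 := HB.pack_for {linear {malg k[B]} -> U} F1
  (GRing.isLinear.Build k _ _ _ F1 l1).
pose L2 := HB.pack_for {linear {malg k[B]} -> U} F2
  (GRing.isLinear.Build k _ _ _ F2 l2).
rewrite -[F1]/(L1 : _ -> _) -[F2]/(L2 : _ -> _) (monalgE p) !linear_sum.
apply: eq_bigr => b _.
have -> : << p@_b *g b >> = p@_b *: single k b :> {malg k[B]}.
  rewrite single.unlock.
  by apply/malgP => c; rewrite mcoeffZ !mcoeffU mulrnAr mulr1.
by rewrite !linearZ /= E.
Qed.

End LinearExtension.

(* Structure constants of an algebra with basis [B] in which the product of two
   basis elements is a multiple of a basis element: b b' = bcoef b b' (bmul b b'). *)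
Record monlaw (k : fieldType) (B : choiceType) := Monlaw {
  bone : B;
  bmul : B -> B -> B;
  bcoef : B -> B -> k;
  bmulA : associative bmul;
  bmul1m : left_id bone bmul;
  bmulm1 : right_id bone bmul;
  bcoef1m : forall b, bcoef bone b = 1;
  bcoefm1 : forall b, bcoef b bone = 1;
  bcoefA : forall b c d,
    bcoef c d * bcoef b (bmul c d) = bcoef b c * bcoef (bmul b c) d
}.

Definition monalgebra (k : fieldType) (B : choiceType) (L : monlaw k B) : Type :=
  {malg k[B]}.

Section MonomialAlgebra.
Variables (k : fieldType) (B : choiceType) (L : monlaw k B).
Local Notation A := (monalgebra L).

HB.instance Definition _ := GRing.Lmodule.copy A {malg k[B]}.

Definition basis (b : B) : A := single k b.

Definition monmul (p q : A) : A :=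
  lext (fun b => lext (fun c => bcoef L b c *: basis (bmul L b c)) q) p.

Lemma monmul_basis b c :
  monmul (basis b) (basis c) = bcoef L b c *: basis (bmul L b c).
Proof. by rewrite /monmul !lextU. Qed.

Lemma monmul_linearl q : linear (monmul^~ q).
Proof. exact: lext_is_linear. Qed.

Lemma monmul_linearr p : linear (monmul p).
Proof.
by move=> c q1 q2; apply: lext_linear_fun => b; rewrite linearP.
Qed.

HB.instance Definition _ p :=
  GRing.isLinear.Build k A A *:%R (monmul p) (monmul_linearr p).

Lemma monmulDl : left_distributive monmul +%R.
Proof. by move=> p q r; apply: (linearD (lext _)). Qed.

Lemma monmulDr : right_distributive monmul +%R.
Proof. by move=> p q r; rewrite linearD. Qed.

Lemma monmulZl c p q : monmul (c *: p) q = c *: monmul p q.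
Proof. exact: (linearZZ (lext _)). Qed.

Lemma monmulZr c p q : monmul p (c *: q) = c *: monmul p q.
Proof. by rewrite linearZ. Qed.

Lemma monmul1m : left_id (basis (bone L)) monmul.
Proof.
apply: malg_lin_ext => [||b]; [exact: monmul_linearr | by [] |].
by rewrite monmul_basis bcoef1m bmul1m scale1r.
Qed.

Lemma monmulm1 : right_id (basis (bone L)) monmul.
Proof.
apply: malg_lin_ext => [||b]; [exact: monmul_linearl | by [] |].
by rewrite -/(basis b) monmul_basis bcoefm1 bmulm1 scale1r.
Qed.

Lemma monmulA : associative monmul.
Proof.
move=> p q r; move: p.
apply: malg_lin_ext => [||b].
- exact: monmul_linearl.
- by move=> c p1 p2; rewrite monmulDl monmulZl monmulDl monmulZl.
move: q; apply: malg_lin_ext => [||c].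
- by move=> c p1 p2; rewrite monmulDl monmulZl monmulDr monmulZr.
- by move=> c p1 p2; rewrite monmulDr monmulZr monmulDl monmulZl.
move: r; apply: malg_lin_ext => [||d].
- by move=> r p1 p2; rewrite monmulDr monmulZr monmulDr monmulZr.
- exact: monmul_linearr.
rewrite -![single k _]/(basis _) !monmul_basis monmulZl monmulZr !monmul_basis.
by rewrite !scalerA bmulA bcoefA.
Qed.

Lemma basis1_neq0 : basis (bone L) != 0.
Proof. by rewrite /basis single.unlock monalgU_eq0 oner_neq0. Qed.

HB.instance Definition _ := GRing.Zmodule_isNzRing.Build A
  monmulA monmul1m monmulm1 monmulDl monmulDr basis1_neq0.

Fact monalgebra_scaleAl c (p q : A) : c *: (p * q) = (c *: p) * q.
Proof. by rewrite [RHS]monmulZl. Qed.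

HB.instance Definition _ := GRing.Lmodule_isLalgebra.Build k A
  monalgebra_scaleAl.

Fact monalgebra_scaleAr c (p q : A) : c *: (p * q) = p * (c *: q).
Proof. by rewrite [RHS]monmulZr. Qed.

HB.instance Definition _ := GRing.Lalgebra_isAlgebra.Build k A
  monalgebra_scaleAr.

Lemma basis1E : basis (bone L) = 1. Proof. by []. Qed.

Lemma basisM b c : basis b * basis c = bcoef L b c *: basis (bmul L b c).
Proof. exact: monmul_basis. Qed.

End MonomialAlgebra.

Section TensorAlgebra.
Variables (k : fieldType) (B1 B2 : choiceType).
Variables (L1 : monlaw k B1) (L2 : monlaw k B2).

(* The basis element (b, c) stands for the pure tensor b (x) c. *)
Program Definition tens_law : monlaw k (B1 * B2)%type := {|
  bone := (bone L1, bone L2);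
  bmul := fun u v => (bmul L1 u.1 v.1, bmul L2 u.2 v.2);
  bcoef := fun u v => bcoef L1 u.1 v.1 * bcoef L2 u.2 v.2
|}.
Next Obligation. by move=> u v w /=; rewrite !bmulA. Qed.
Next Obligation. by move=> [b c] /=; rewrite !bmul1m. Qed.
Next Obligation. by move=> [b c] /=; rewrite !bmulm1. Qed.
Next Obligation. by rewrite /= !bcoef1m mulr1. Qed.
Next Obligation. by rewrite /= !bcoefm1 mulr1. Qed.
Next Obligation. by rewrite /= mulrACA !bcoefA mulrACA. Qed.

Definition tens_elt (p : monalgebra L1) (q : monalgebra L2) :
    monalgebra tens_law :=
  lext (fun b => lext (fun c => basis tens_law (b, c)) q) p.

Lemma tens_elt_basis b c :
  tens_elt (basis L1 b) (basis L2 c) = basis tens_law (b, c).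
Proof. by rewrite /tens_elt !lextU. Qed.

Lemma tens_elt_linearl q : linear (tens_elt^~ q).
Proof. exact: lext_is_linear. Qed.

Lemma tens_elt_linearr p : linear (tens_elt p).
Proof.
by move=> c q1 q2; apply: lext_linear_fun => b; rewrite linearP.
Qed.

Lemma tens_eltM p p' q q' :
  tens_elt p q * tens_elt p' q' = tens_elt (p * p') (q * q').
Proof.
have dl := tens_elt_linearl; have dr := tens_elt_linearr.
move: p; apply: malg_lin_ext => [c p1 p2|c p1 p2|b1].
- by rewrite dl mulrDl -scalerAl.
- by rewrite mulrDl -scalerAl dl.
move: p'; apply: malg_lin_ext => [c p1 p2|c p1 p2|b2].
- by rewrite dl mulrDr -scalerAr.
- by rewrite mulrDr -scalerAr dl.
move: q; apply: malg_lin_ext => [c p1 p2|c p1 p2|c1].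
- by rewrite dr mulrDl -scalerAl.
- by rewrite mulrDl -scalerAl dr.
move: q'; apply: malg_lin_ext => [c p1 p2|c p1 p2|c2].
- by rewrite dr mulrDr -scalerAr.
- by rewrite mulrDr -scalerAr dr.
rewrite -[single k b1]/(basis L1 b1) -[single k b2]/(basis L1 b2).
rewrite -[single k c1]/(basis L2 c1) -[single k c2]/(basis L2 c2).
rewrite !tens_elt_basis !basisM (linear_scale (dl _)) (linear_scale (dr _)).
by rewrite tens_elt_basis scalerA.
Qed.

Lemma tens_elt1 : tens_elt 1 1 = 1.
Proof. exact: tens_elt_basis. Qed.

End TensorAlgebra.

Lemma qcomm_exp (k : fieldType) (A : algType k) (c : k) (x u : A) i :
  x * u = c *: (u * x) -> x ^+ i * u = c ^+ i *: (u * x ^+ i).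
Proof.
move=> E; elim: i => [|i IH]; first by rewrite !expr0 scale1r mul1r mulr1.
rewrite [in LHS]exprSr -[LHS]mulrA E -[LHS]scalerAr (mulrA (x ^+ i)) IH.
by rewrite -scalerAl scalerA -exprS -mulrA -exprSr.
Qed.

Lemma qcomm_mul (k : fieldType) (A : algType k) (c : k) (x u v : A) i j :
  x * v = c *: (v * x) ->
  (u * x ^+ i) * (v * x ^+ j) = c ^+ i *: (u * v * x ^+ (i + j)).
Proof.
move=> /(qcomm_exp i) E; rewrite -!mulrA (mulrA _ v) E exprD -scalerAl.
by rewrite -scalerAr -!mulrA.
Qed.

(* Group homomorphisms from [G] to the multiplicative group of [k]. *)
Record character (G : groupType) (k : fieldType) := Character {
  char_fun :> G -> k;
  char_neq0 : forall g, char_fun g != 0;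
  charM : forall g h, char_fun (g * h)%g = char_fun g * char_fun h
}.

Section Characters.
Variables (G : groupType) (k : fieldType).
Implicit Types chi psi : character G k.

Lemma char1 chi : chi 1%g = 1.
Proof.
by apply: (mulfI (char_neq0 chi 1%g)); rewrite -charM mulg1 mulr1.
Qed.

Program Definition char_one : character G k := {| char_fun := fun=> 1 |}.
Next Obligation. exact: oner_neq0. Qed.
Next Obligation. by rewrite mulr1. Qed.

Program Definition char_mul chi psi : character G k :=
  {| char_fun := fun g => chi g * psi g |}.
Next Obligation. by rewrite mulf_neq0 ?char_neq0. Qed.
Next Obligation. by rewrite !charM mulrACA. Qed.

Program Definition char_inv chi : character G k :=
  {| char_fun := fun g => (chi g)^-1 |}.
Next Obligation. by rewrite invr_eq0 char_neq0. Qed.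
Next Obligation. by rewrite charM invfM. Qed.

Program Definition char_exp chi (n : nat) : character G k :=
  {| char_fun := fun g => chi g ^+ n |}.
Next Obligation. by rewrite expf_neq0 ?char_neq0. Qed.
Next Obligation. by rewrite charM exprMn. Qed.

Definition char_order chi (s : nat) : Prop :=
  [/\ (0 < s)%N, char_exp chi s =1 char_one
    & forall t : nat, (0 < t < s)%N -> ~ char_exp chi t =1 char_one].

Definition central (a : G) : Prop := forall g : G, commute a g.

End Characters.

Section HopfOre.
Variables (k : fieldType) (G : groupType) (chi : character G k).

(* The basis element (g, i) stands for g x^i.  Moving the powers of x to the
   right with x h = chi^-1(h) h x gives
   (g x^i) (h x^j) = chi^-1(h)^i (g h) x^(i + j). *)
Program Definition hopf_law : monlaw k (G * nat)%type := {|
  bone := (1%g, 0%N);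
  bmul := fun u v => ((u.1 * v.1)%g, (u.2 + v.2)%N);
  bcoef := fun u v => char_inv chi v.1 ^+ u.2
|}.
Next Obligation. by move=> u v w /=; rewrite mulgA addnA. Qed.
Next Obligation. by move=> [g i] /=; rewrite mul1g. Qed.
Next Obligation. by move=> [g i] /=; rewrite mulg1 addn0. Qed.
Next Obligation. by rewrite /= char1 invr1 expr1n. Qed.
Next Obligation.
rewrite /= charM invfM exprMn exprD mulrCA; congr (_ * _).
by rewrite mulrC.
Qed.

Definition hgrp (g : G) : monalgebra hopf_law := basis hopf_law (g, 0%N).
Definition hx : monalgebra hopf_law := basis hopf_law (1%g, 1%N).

Local Notation H := (monalgebra hopf_law).
Local Notation HH := (monalgebra (tens_law hopf_law hopf_law)).

Lemma hgrp1 : hgrp 1%g = 1. Proof. by []. Qed.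

Lemma hgrpM g h : hgrp (g * h)%g = hgrp g * hgrp h.
Proof. by rewrite [RHS]basisM /= expr0 scale1r. Qed.

Lemma hx_grp g : hx * hgrp g = (char_inv chi g) *: (hgrp g * hx).
Proof.
by rewrite /hx /hgrp !basisM /= expr1 expr0 scale1r mul1g mulg1.
Qed.

Lemma hopf_basisE g i : basis hopf_law (g, i) = hgrp g * hx ^+ i.
Proof.
elim: i => [|i IH]; first by rewrite expr0 mulr1.
rewrite exprSr mulrA -IH [RHS]basisM /= char1 invr1 expr1n scale1r.
by rewrite mulg1 addn1.
Qed.

Variables (a : G) (aZ : central a).

(* The coproduct: the algebra morphism with g |-> g (x) g and
   x |-> x (x) a + 1 (x) x.  It is multiplicative because [a] is central. *)
Definition comul (_ : central a) : H -> HH :=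
  lext (fun u : G * nat => tens_elt (hgrp u.1) (hgrp u.1)
                           * (tens_elt hx (hgrp a) + tens_elt 1 hx) ^+ u.2).

HB.instance Definition _ :=
  GRing.isLinear.Build k H HH *:%R (comul aZ) (lext_is_linear _).

Lemma comul_basis g i : comul aZ (basis hopf_law (g, i)) =
  tens_elt (hgrp g) (hgrp g) * (tens_elt hx (hgrp a) + tens_elt 1 hx) ^+ i.
Proof. exact: lextU. Qed.

Lemma comul_x_grp h :
  (tens_elt hx (hgrp a) + tens_elt 1 hx) * tens_elt (hgrp h) (hgrp h) =
  char_inv chi h *: (tens_elt (hgrp h) (hgrp h)
                     * (tens_elt hx (hgrp a) + tens_elt 1 hx)).
Proof.
rewrite mulrDl mulrDr !tens_eltM mul1r mulr1 -!hgrpM (aZ h) hx_grp.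
rewrite (linear_scale (tens_elt_linearl _)) (linear_scale (tens_elt_linearr _)).
by rewrite scalerDr.
Qed.

Fact comul_is_monoid_morphism : monoid_morphism (comul aZ).
Proof.
split=> [|p q].
  by rewrite -hgrp1 comul_basis expr0 mulr1 hgrp1 tens_elt1.
move: p; apply: malg_lin_ext => [c p1 p2|c p1 p2|[g i]].
- by rewrite mulrDl -scalerAl linearP.
- by rewrite linearP mulrDl -scalerAl.
move: q; apply: malg_lin_ext => [c p1 p2|c p1 p2|[h j]].
- by rewrite mulrDr -scalerAr linearP.
- by rewrite linearP mulrDr -scalerAr.
rewrite -[single k (g, i)]/(basis hopf_law (g, i)).
rewrite -[single k (h, j)]/(basis hopf_law (h, j)).
rewrite basisM linearZ /= !comul_basis.
by rewrite hgrpM -tens_eltM (qcomm_mul _ _ _ (comul_x_grp h)).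
Qed.

HB.instance Definition _ :=
  GRing.isMonoidMorphism.Build H HH (comul aZ) comul_is_monoid_morphism.

Lemma comul_grp g : comul aZ (hgrp g) = tens_elt (hgrp g) (hgrp g).
Proof. by rewrite comul_basis expr0 mulr1. Qed.

Lemma comul_hx : comul aZ hx = tens_elt hx (hgrp a) + tens_elt 1 hx.
Proof. by rewrite comul_basis expr1 hgrp1 tens_elt1 mul1r. Qed.

End HopfOre.

Arguments comul {k G} chi {a} aZ p.

Notation hopf chi := (monalgebra (hopf_law chi)).

Record fdmod (k : fieldType) (A : algType k) := Fdmod {
  fdmod_space :> vectType k;
  act : {linear A -> 'End(fdmod_space)};
  act1 : act 1 = \1%VF;
  actM : forall p q, act (p * q) = (act p \o act q)%VF
}.
Arguments act {k A} M : rename.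

Section Modules.
Variables (k : fieldType) (A : algType k).

Definition fdmod_iso (M N : fdmod A) : Prop :=
  exists2 f : 'Hom(M, N),
    bijective f & forall (p : A) (m : M), f (act M p m) = act N p (f m).

Program Definition fdmod_pullback (A' : algType k) (phi : {lrmorphism A -> A'})
    (M : fdmod A') : fdmod A :=
  @Fdmod k A M (act M \o phi) _ _.
Next Obligation. by rewrite /= rmorph1 act1. Qed.
Next Obligation. by rewrite /= rmorphM actM. Qed.

Variables (n : nat) (M : 'I_n -> fdmod A).

Definition dsum_space : Type := {dffun forall i : 'I_n, M i}.

HB.instance Definition _ :=
  Choice.copy dsum_space {dffun forall i : 'I_n, M i}.

Implicit Types v w : dsum_space.

Definition dsum_zero : dsum_space := finfun (fun i => 0 : M i).
Definition dsum_opp v : dsum_space := finfun (fun i => - v i).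
Definition dsum_add v w : dsum_space := finfun (fun i => v i + w i).
Definition dsum_scale (c : k) v : dsum_space := finfun (fun i => c *: v i).

Fact dsum_addA : associative dsum_add.
Proof. by move=> u v w; apply/ffunP => i; rewrite !ffunE addrA. Qed.
Fact dsum_addC : commutative dsum_add.
Proof. by move=> u v; apply/ffunP => i; rewrite !ffunE addrC. Qed.
Fact dsum_add0 : left_id dsum_zero dsum_add.
Proof. by move=> u; apply/ffunP => i; rewrite !ffunE add0r. Qed.
Fact dsum_addN : left_inverse dsum_zero dsum_opp dsum_add.
Proof. by move=> u; apply/ffunP => i; rewrite !ffunE addNr. Qed.

HB.instance Definition _ := GRing.isZmodule.Build dsum_space
  dsum_addA dsum_addC dsum_add0 dsum_addN.

Fact dsum_scaleA c d v : dsum_scale c (dsum_scale d v) = dsum_scale (c * d) v.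
Proof. by apply/ffunP => i; rewrite !ffunE scalerA. Qed.
Fact dsum_scale1 : left_id 1 dsum_scale.
Proof. by move=> v; apply/ffunP => i; rewrite !ffunE scale1r. Qed.
Fact dsum_scaleDr : right_distributive dsum_scale +%R.
Proof. by move=> c v w; apply/ffunP => i; rewrite !ffunE scalerDr. Qed.
Fact dsum_scaleDl v : {morph dsum_scale^~ v : c d / c + d}.
Proof. by move=> c d; apply/ffunP => i; rewrite !ffunE scalerDl. Qed.

HB.instance Definition _ := GRing.Zmodule_isLmodule.Build k dsum_space
  dsum_scaleA dsum_scale1 dsum_scaleDr dsum_scaleDl.

Lemma dsumDE v w i : (v + w) i = v i + w i.
Proof. by rewrite ffunE. Qed.
Lemma dsumZE c v i : (c *: v) i = c *: v i.
Proof. by rewrite ffunE. Qed.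

Fact dsum_vect_iso : Vector.axiom (\sum_i \dim {:M i})%N dsum_space.
Proof.
pose f (v : dsum_space) := \mxrow_i \row_j coord (vbasis {:M i}) j (v i).
pose g (r : 'rV_(\sum_i \dim {:M i})) : dsum_space :=
  finfun (fun i => \sum_j submxrow r i 0 j *: (vbasis {:M i})`_j).
exists f => [c v w|].
  apply/mxrowP => i; rewrite submxrowD.
  have -> : submxrow (c *: f v) i = c *: submxrow (f v) i.
    by apply/rowP => l; rewrite !mxE.
  by rewrite !mxrowK dsumDE dsumZE; apply/rowP => l; rewrite !mxE linearP.
exists g.
  move=> v; apply/ffunP => i; rewrite ffunE mxrowK.
  rewrite [RHS](coord_vbasis (memvf (v i))); apply: eq_bigr => j _.
  by rewrite mxE.
move=> r; apply/mxrowP => i; rewrite mxrowK; apply/rowP => j.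
by rewrite mxE ffunE coord_sum_free // (basis_free (vbasisP _)).
Qed.

HB.instance Definition _ := Lmodule_hasFinDim.Build k dsum_space dsum_vect_iso.

Definition dsum_act_fun (p : A) v : dsum_space :=
  finfun (fun i => act (M i) p (v i)).

Fact dsum_act_fun_linear p : linear (dsum_act_fun p).
Proof.
by move=> c v w; apply/ffunP => i; rewrite dsumDE dsumZE !ffunE linearP.
Qed.
HB.instance Definition _ p := GRing.isLinear.Build k dsum_space dsum_space *:%R
  (dsum_act_fun p) (dsum_act_fun_linear p).

Definition dsum_act (p : A) : 'End(dsum_space) := linfun (dsum_act_fun p).

Lemma dsum_actE p v i : dsum_act p v i = act (M i) p (v i).
Proof. by rewrite lfunE ffunE. Qed.

Fact dsum_act_linear : linear dsum_act.
Proof.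
move=> c p q; apply/lfunP => v; apply/ffunP => i.
by rewrite !lfun_simp dsumDE dsumZE /= !ffunE linearP /= !lfun_simp.
Qed.
HB.instance Definition _ := GRing.isLinear.Build k A 'End(dsum_space) *:%R
  dsum_act dsum_act_linear.

Program Definition dsum : fdmod A := @Fdmod k A dsum_space dsum_act _ _.
Next Obligation.
by apply/lfunP => v; apply/ffunP => i; rewrite dsum_actE act1 !lfunE.
Qed.
Next Obligation.
by apply/lfunP => v; apply/ffunP => i; rewrite comp_lfunE !dsum_actE actM lfunE.
Qed.

End Modules.

Section TensorSpace.
Variables (k : fieldType) (V W : vectType k).

(* The tensor product of two finite-dimensional spaces, in coordinates: the
   (i, j) entry is the coefficient of (vbasis V)_i (x) (vbasis W)_j. *)
Definition tens_space : vectType k := 'M[k]_(\dim {:V}, \dim {:W}).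

Definition tens_vec (v : V) (w : W) : tens_space :=
  \matrix_(i, j) (coord (vbasis {:V}) i v * coord (vbasis {:W}) j w).

Lemma tens_vec_linearl w : linear (tens_vec^~ w).
Proof.
move=> c v v'; apply/matrixP => i j.
by rewrite !mxE linearP mulrDl -mulrA.
Qed.

Lemma tens_vec_linearr v : linear (tens_vec v).
Proof.
move=> c w w'; apply/matrixP => i j.
by rewrite !mxE linearP mulrDr mulrCA.
Qed.

Section Lift.
Variables (U : lmodType k) (f : V -> W -> U).

(* The linear map induced by the bilinear map [f]. *)
Definition tens_lift (z : tens_space) : U :=
  \sum_i \sum_j z i j *: f (vbasis {:V})`_i (vbasis {:W})`_j.

Fact tens_lift_linear : linear tens_lift.
Proof.
move=> c z z'; rewrite /tens_lift scaler_sumr -big_split; apply: eq_bigr => i _.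
rewrite scaler_sumr -big_split; apply: eq_bigr => j _ /=.
by rewrite !mxE scalerDl scalerA.
Qed.
HB.instance Definition _ :=
  GRing.isLinear.Build k tens_space U *:%R tens_lift tens_lift_linear.

Lemma tens_liftE (fl : forall w, linear (f^~ w)) (fr : forall v, linear (f v))
  v w : tens_lift (tens_vec v w) = f v w.
Proof.
pose F1 w := HB.pack_for {linear V -> U} (f^~ w)
  (GRing.isLinear.Build k _ _ _ (f^~ w) (fl w)).
pose F2 v := HB.pack_for {linear W -> U} (f v)
  (GRing.isLinear.Build k _ _ _ (f v) (fr v)).
rewrite [in RHS](coord_vbasis (memvf v)) -[RHS]/(F1 w _) linear_sum.
apply: eq_bigr => i _; rewrite linearZ /=.
rewrite [in RHS](coord_vbasis (memvf w)) -[f _ _]/(F2 _ _) linear_sum scaler_sumr.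
by apply: eq_bigr => j _; rewrite mxE linearZ /= scalerA.
Qed.

End Lift.

Lemma tens_vec_gen (z : tens_space) :
  z = \sum_i \sum_j z i j *: tens_vec (vbasis {:V})`_i (vbasis {:W})`_j.
Proof.
have fV := basis_free (vbasisP {:V}); have fW := basis_free (vbasisP {:W}).
apply/matrixP => i j; rewrite summxE (bigD1 i) //= summxE (bigD1 j) //=.
rewrite !mxE !coord_free // !eqxx !mulr1 !big1 ?addr0 // => [i' ne|j' ne].
  rewrite summxE big1 // => j' _; rewrite !mxE coord_free //.
  by rewrite (negPf ne) mul0r mulr0.
by rewrite !mxE !coord_free // (negPf ne) !mulr0.
Qed.

Lemma tens_ext (U : lmodType k) (f g : {linear tens_space -> U}) :
  (forall v w, f (tens_vec v w) = g (tens_vec v w)) -> f =1 g.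
Proof.
move=> E z; rewrite [z]tens_vec_gen !linear_sum; apply: eq_bigr => i _.
by rewrite !linear_sum; apply: eq_bigr => j _; rewrite !linearZ /= E.
Qed.

(* The map f (x) g. *)
Definition tens_fun (f : 'End(V)) (g : 'End(W)) : 'End(tens_space) :=
  linfun (tens_lift (fun v w => tens_vec (f v) (g w))).

Lemma tens_funE f g v w : tens_fun f g (tens_vec v w) = tens_vec (f v) (g w).
Proof.
rewrite lfunE /= tens_liftE // => [w'|v'] c u u'; rewrite linearP.
  exact: tens_vec_linearl.
exact: tens_vec_linearr.
Qed.

Lemma tens_lfunP (F F' : 'End(tens_space)) :
  (forall v w, F (tens_vec v w) = F' (tens_vec v w)) -> F = F'.
Proof. by move=> E; apply/lfunP; apply: tens_ext. Qed.

Lemma tens_fun_linearl g : linear (tens_fun^~ g).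
Proof.
move=> c f f'; apply: tens_lfunP => v w.
by rewrite add_lfunE scale_lfunE !tens_funE add_lfunE scale_lfunE
  tens_vec_linearl.
Qed.

Lemma tens_fun_linearr f : linear (tens_fun f).
Proof.
move=> c g g'; apply: tens_lfunP => v w.
by rewrite add_lfunE scale_lfunE !tens_funE add_lfunE scale_lfunE
  tens_vec_linearr.
Qed.

Lemma tens_fun1 : tens_fun \1%VF \1%VF = \1%VF.
Proof. by apply: tens_lfunP => v w; rewrite tens_funE !lfunE. Qed.

Lemma tens_fun_comp f f' g g' :
  (tens_fun f g \o tens_fun f' g')%VF = tens_fun (f \o f')%VF (g \o g')%VF.
Proof.
by apply: tens_lfunP => v w; rewrite comp_lfunE !tens_funE !comp_lfunE.
Qed.

End TensorSpace.

Section TensorModule.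
Variables (k : fieldType) (B1 B2 : choiceType).
Variables (L1 : monlaw k B1) (L2 : monlaw k B2).
Variables (V : fdmod (monalgebra L1)) (W : fdmod (monalgebra L2)).
Local Notation A12 := (monalgebra (tens_law L1 L2)).

Definition outer_act : A12 -> 'End(tens_space V W) :=
  lext (fun u => tens_fun (act V (basis L1 u.1)) (act W (basis L2 u.2))).

HB.instance Definition _ := GRing.isLinear.Build k A12 _ *:%R outer_act
  (lext_is_linear _).

Fact outer_act1 : outer_act 1 = \1%VF.
Proof. by rewrite /outer_act lextU !basis1E !act1 tens_fun1. Qed.

Fact outer_actM p q : outer_act (p * q) = (outer_act p \o outer_act q)%VF.
Proof.
move: p; apply: malg_lin_ext => [||b].
- by move=> c p1 p2; rewrite mulrDl -scalerAl linearP.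
- by move=> c p1 p2; rewrite linearP /= comp_lfunDl comp_lfunZl.
move: q; apply: malg_lin_ext => [||c].
- by move=> c p1 p2; rewrite mulrDr -scalerAr linearP.
- by move=> c p1 p2; rewrite linearP /= comp_lfunDr comp_lfunZr.
rewrite -![single k _]/(basis (tens_law L1 L2) _) basisM linearZ /=.
rewrite /outer_act !lextU tens_fun_comp -!actM !basisM !linearZ /=.
rewrite (linear_scale (tens_fun_linearl _)) (linear_scale (tens_fun_linearr _)).
by rewrite scalerA.
Qed.

(* The module over the tensor product algebra in which
   (p (x) q) (v (x) w) = p v (x) q w. *)
Definition outer_tens : fdmod A12 := Fdmod outer_act1 outer_actM.

Lemma outer_tensE p q v w :
  act outer_tens (tens_elt p q) (tens_vec v w) = tens_vec (act V p v) (act W q w).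
Proof.
move: p; apply: malg_lin_ext => [||b].
- by move=> c p1 p2; rewrite tens_elt_linearl linearP !lfun_simp.
- move=> c p1 p2; rewrite linearP add_lfunE scale_lfunE.
  exact: tens_vec_linearl.
move: q; apply: malg_lin_ext => [||c].
- by move=> c p1 p2; rewrite tens_elt_linearr linearP !lfun_simp.
- move=> c p1 p2; rewrite linearP add_lfunE scale_lfunE.
  exact: tens_vec_linearr.
rewrite -[single k b]/(basis L1 b) -[single k c]/(basis L2 c) tens_elt_basis.
by rewrite /= /outer_act lextU tens_funE.
Qed.

End TensorModule.

Section HopfModules.
Variables (k : fieldType) (G : groupType) (chi : character G k).
Local Notation H := (hopf chi).

Definition hopf_tens (a : G) (aZ : central a) (V W : fdmod H) : fdmod H :=
  fdmod_pullback (comul chi aZ) (outer_tens V W).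

Lemma hopf_tens_grp (a : G) (aZ : central a) (V W : fdmod H) g v w :
  act (hopf_tens aZ V W) (hgrp chi g) (tens_vec v w) =
  tens_vec (act V (hgrp chi g) v) (act W (hgrp chi g) w).
Proof.
rewrite -[LHS]/(act (outer_tens V W) (comul chi aZ (hgrp chi g)) _) comul_grp.
exact: outer_tensE.
Qed.

Lemma hopf_tens_x (a : G) (aZ : central a) (V W : fdmod H) v w :
  act (hopf_tens aZ V W) (hx chi) (tens_vec v w) =
  tens_vec (act V (hx chi) v) (act W (hgrp chi a) w)
  + tens_vec v (act W (hx chi) w).
Proof.
rewrite -[LHS]/(act (outer_tens V W) (comul chi aZ (hx chi)) _) comul_hx.
by rewrite linearD add_lfunE !outer_tensE act1 lfunE.
Qed.

Lemma hopf_hom_gen (M N : fdmod H) (f : 'Hom(M, N)) :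
  (forall g m, f (act M (hgrp chi g) m) = act N (hgrp chi g) (f m)) ->
  (forall m, f (act M (hx chi) m) = act N (hx chi) (f m)) ->
  forall p m, f (act M p m) = act N p (f m).
Proof.
move=> fg fx p m; move: p; apply: malg_lin_ext => [c p q|c p q|[g i]].
- by rewrite linearP add_lfunE scale_lfunE linearP.
- by rewrite linearP add_lfunE scale_lfunE.
rewrite -[single _ _]/(basis (hopf_law chi) (g, i)) hopf_basisE !actM !comp_lfunE.
rewrite fg; congr (act N _ _); elim: i m => [|i IH] m.
  by rewrite !expr0 !act1 !lfunE.
by rewrite !exprS !actM !comp_lfunE fx IH.
Qed.

(* Since [H] is presented by generators and relations, an action of [H] is given
   by operators [rho g] and [xi] satisfying these relations. *)
Section Generators.
Variables (V : vectType k) (rho : G -> 'End(V)) (xi : 'End(V)).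
Hypothesis rho1 : rho 1%g = \1%VF.
Hypothesis rhoM : forall g h, rho (g * h)%g = (rho g \o rho h)%VF.
Hypothesis xi_rho :
  forall g, (xi \o rho g = char_inv chi g *: (rho g \o xi))%VF.

Definition lfun_iter (i : nat) : 'End(V) := iter i (comp_lfun xi) \1%VF.

Definition gen_act : H -> 'End(V) :=
  lext (fun u : G * nat => (rho u.1 \o lfun_iter u.2)%VF).

HB.instance Definition _ :=
  GRing.isLinear.Build k H 'End(V) *:%R gen_act (lext_is_linear _).

Lemma lfun_iterD i j : lfun_iter (i + j) = (lfun_iter i \o lfun_iter j)%VF.
Proof.
elim: i => [|i IH]; first by rewrite comp_lfun1l.
by rewrite addSn /= -/(lfun_iter _) IH comp_lfunA.
Qed.

Lemma lfun_iter_rho i g : (lfun_iter i \o rho g)%VF =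
  char_inv chi g ^+ i *: (rho g \o lfun_iter i)%VF.
Proof.
elim: i => [|i IH]; first by rewrite comp_lfun1l comp_lfun1r scale1r.
rewrite /= -/(lfun_iter _) -comp_lfunA IH -comp_lfunZr (comp_lfunA xi) xi_rho.
by rewrite -comp_lfunZl scalerA -comp_lfunA -exprSr.
Qed.

Fact gen_act1 : gen_act 1 = \1%VF.
Proof. by rewrite /gen_act lextU rho1 comp_lfun1l. Qed.

Fact gen_actM p q : gen_act (p * q) = (gen_act p \o gen_act q)%VF.
Proof.
move: p; apply: malg_lin_ext => [||[g i]].
- by move=> c p1 p2; rewrite mulrDl -scalerAl linearP.
- by move=> c p1 p2; rewrite linearP /= comp_lfunDl comp_lfunZl.
move: q; apply: malg_lin_ext => [||[h j]].
- by move=> c p1 p2; rewrite mulrDr -scalerAr linearP.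
- by move=> c p1 p2; rewrite linearP /= comp_lfunDr comp_lfunZr.
rewrite -![single k _]/(basis (hopf_law chi) _) basisM linearZ /=.
rewrite /gen_act !lextU /= rhoM lfun_iterD.
have E := lfun_iter_rho i h.
have -> : ((rho g \o lfun_iter i) \o (rho h \o lfun_iter j) =
           rho g \o ((lfun_iter i \o rho h) \o lfun_iter j))%VF.
  by rewrite -comp_lfunA (comp_lfunA (lfun_iter i)).
rewrite E -comp_lfunZl -comp_lfunZr; congr (_ *: _).
by rewrite -comp_lfunA (comp_lfunA (rho h)).
Qed.

Definition gen_mod : fdmod H := Fdmod gen_act1 gen_actM.

Lemma gen_mod_grp g : act gen_mod (hgrp chi g) = rho g.
Proof. by rewrite /= /gen_act lextU /= comp_lfun1r. Qed.

Lemma gen_mod_x : act gen_mod (hx chi) = xi.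
Proof. by rewrite /= /gen_act lextU /= rho1 comp_lfun1l comp_lfun1r. Qed.

End Generators.

Section CyclicModules.
Variables (s : nat) (chi_s : char_order chi s).
Variables (lambda : character G k) (gamma : k).
Local Notation V := 'rV[k]_s.

Definition vbase (i : nat) : V := \row_(j < s) (j == i :> nat)%:R.

(* The endomorphism with m_i |-> f i. *)
Definition vbase_lift (f : nat -> V) : 'End(V) :=
  linfun (mulmxr (\matrix_(i < s) f i)).

Lemma vbase_liftE f i : (i < s)%N -> vbase_lift f (vbase i) = f i.
Proof.
move=> lis; rewrite lfunE /= (_ : vbase i = delta_mx 0 (Ordinal lis)).
  by rewrite -rowE rowK.
by apply/rowP => j; rewrite !mxE.
Qed.

Lemma vbase_lfunP (F F' : 'End(V)) :
  (forall i, (i < s)%N -> F (vbase i) = F' (vbase i)) -> F = F'.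
Proof.
move=> E; apply/lfunP => v; rewrite (row_sum_delta v) !linear_sum.
apply: eq_bigr => i _; rewrite !linearZ /= (_ : delta_mx 0 i = vbase i) ?E //.
by apply/rowP => j; rewrite !mxE.
Qed.

Definition Vgrp (g : G) : 'End(V) :=
  vbase_lift (fun i => (chi g ^+ i * lambda g) *: vbase i).

Definition Vx : 'End(V) :=
  vbase_lift (fun i => if (i.+1 < s)%N then vbase i.+1 else gamma *: vbase 0).

Fact Vgrp1 : Vgrp 1%g = \1%VF.
Proof.
apply: vbase_lfunP => i lis.
by rewrite vbase_liftE // lfunE !char1 expr1n mulr1 scale1r.
Qed.

Fact VgrpM g h : Vgrp (g * h)%g = (Vgrp g \o Vgrp h)%VF.
Proof.
apply: vbase_lfunP => i lis; rewrite comp_lfunE !vbase_liftE // linearZ /=.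
rewrite vbase_liftE // scalerA !charM exprMn; congr (_ *: _).
by rewrite mulrACA [RHS]mulrC.
Qed.

Fact Vx_grp g : (Vx \o Vgrp g = char_inv chi g *: (Vgrp g \o Vx))%VF.
Proof.
case: chi_s => s_gt0 chi_s1 _.
apply: vbase_lfunP => i lis; rewrite scale_lfunE !comp_lfunE !vbase_liftE //.
rewrite !linearZ /= vbase_liftE //; case: ltnP => lis1.
  rewrite vbase_liftE // scalerA exprS -!mulrA mulKf ?char_neq0 //.
rewrite [Vgrp g _]linearZ /= vbase_liftE // !scalerA expr0 mul1r.
have Es : i.+1 = s by apply/eqP; rewrite eqn_leq lis.
have E : chi g ^+ i * chi g = 1 by rewrite -exprSr Es; apply: chi_s1.
have -> : chi g ^+ i = (chi g)^-1.
  by apply: (mulIf (char_neq0 chi g)); rewrite E mulVf ?char_neq0.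
by congr (_ *: _); rewrite -!mulrA [lambda g * _]mulrC.
Qed.

Definition Vmod : fdmod H := gen_mod Vgrp1 VgrpM Vx_grp.

Lemma Vmod_grp g i : (i < s)%N ->
  act Vmod (hgrp chi g) (vbase i) = (chi g ^+ i * lambda g) *: vbase i.
Proof. by move=> lis; rewrite gen_mod_grp vbase_liftE. Qed.

Lemma Vmod_x i : (i.+1 < s)%N -> act Vmod (hx chi) (vbase i) = vbase i.+1.
Proof. by move=> lis; rewrite gen_mod_x vbase_liftE ?lis // ltnW. Qed.

Lemma Vmod_x_last : act Vmod (hx chi) (vbase s.-1) = gamma *: vbase 0.
Proof.
case: chi_s => s_gt0 _ _.
by rewrite gen_mod_x vbase_liftE prednK // ltnn.
Qed.

End CyclicModules.

End HopfModules.

(* Main.v *)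
Require Import Defs.
From HB Require Import structures.
From mathcomp Require Import all_boot all_order all_algebra.
From mathcomp Require Import ring.

Set Implicit Arguments.
Unset Strict Implicit.
Unset Printing Implicit Defensive.

Import GRing.Theory.
Local Open Scope ring_scope.

(** Let [q] be the inverse of [chi a].  In H (x) H the summands X = x (x) a and
    Y = 1 (x) x of the coproduct of x satisfy Y X = q X Y, so the powers of X + Y
    are given by the q-binomial theorem ([qbinomial]).

    - Since [q] is a primitive s-th root of unity, the middle q-binomial
      coefficients of level s vanish and (X + Y)^s = X^s + Y^s
      ([qbinomial_prim_root]).  On V(lambda, gamma) the element x^s acts as the
      scalar gamma and a^s as the scalar lambda(a)^s, because chi^s = 1.  Hence
      x^s acts on the tensor product as the scalar alpha lambda(a)^s + beta.

    - The vector m_0 (x) n_t has weight chi^t sigma lambda.  By the universal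
      property of the cyclic modules ([Vmod_hom_act]) it is the image of m_0
      under a morphism from V(chi^t sigma lambda, alpha lambda(a)^s + beta), and
      these morphisms add up to a morphism from the direct sum.

    - This morphism is onto: by the q-binomial theorem x^i (m_0 (x) w) is
      m_i (x) a^i w plus terms m_j (x) w' with j < i, and a^i is invertible.  By
      induction on i every m_i (x) w lies in any subspace that is stable under x
      and contains m_0 (x) W ([hopf_tens_generation]).  Both sides have dimension s^2, so the
      morphism is an isomorphism. *)

(** * The q-binomial theorem *)

Section QBinomial.
Variables (k : fieldType) (q : k).

(** Gaussian binomial coefficients.  They are defined by a Pascal rule, and not as
    quotients of q-factorials, because the q-factorials of all n >= s vanish when
    q is a primitive s-th root of unity and s > 1. *)
Fixpoint qbin (n j : nat) : k :=
  match n, j with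
  | _, 0 => 1
  | 0, _.+1 => 0
  | n'.+1, j'.+1 => qbin n' j' + q ^+ j * qbin n' j
  end.

Lemma qbinn0 n : qbin n 0 = 1. Proof. by case: n. Qed.

Lemma qbinSS n j : qbin n.+1 j.+1 = qbin n j + q ^+ j.+1 * qbin n j.+1.
Proof. by []. Qed.

Lemma qbin_small n j : (n < j)%N -> qbin n j = 0.
Proof.
elim: n j => [|n IH] [|j] //= lt_nj.
by rewrite (IH j) // (IH j.+1) ?mulr0 ?addr0 // ltnW.
Qed.

Lemma qbinnn n : qbin n n = 1.
Proof. by elim: n => //= n ->; rewrite qbin_small // mulr0 addr0. Qed.

(** The ratio of consecutive coefficients, cleared of denominators.  The factor
    q^j keeps the identity free of truncated exponents n - j: both sides vanish
    when n < j. *)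
Lemma qbin_step n j :
  q ^+ j * (1 - q ^+ j.+1) * qbin n j.+1 = (q ^+ j - q ^+ n) * qbin n j.
Proof.
elim: n j => [|n IH] [|j].
- by rewrite /= expr0 subrr mul0r mulr0.
- by rewrite /= !mulr0.
- rewrite qbinSS !qbinn0; have := IH 0; rewrite qbinn0 !exprS !expr0.
  set b := qbin n 1; set Q := q ^+ n => E.
  have -> : 1 * (1 - q * 1) * (1 + q * 1 * b) =
            (1 - q) + q * (1 * (1 - q * 1) * b) by ring.
  by rewrite E; ring.
rewrite !qbinSS; move: (IH j) (IH j.+1); rewrite !exprS.
move: (qbin n j) (qbin n j.+1) (qbin n j.+2) (q ^+ j) (q ^+ n).
move=> b0 b1 b2 Qj Qn E0 E1.
have -> : q * Qj * (1 - q * (q * Qj)) * (b1 + q * (q * Qj) * b2) =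
  q * Qj * (1 - q * (q * Qj)) * b1
  + q * (q * Qj) * (q * Qj * (1 - q * (q * Qj)) * b2) by ring.
have -> : (q * Qj - q * Qn) * (b0 + q * Qj * b1) =
  q * ((Qj - Qn) * b0) + (q * Qj - q * Qn) * (q * Qj * b1) by ring.
by rewrite E1 -E0; ring.
Qed.

(** At level s the ratio identity reads
    q^j (1 - q^(j+1)) qbin s (j+1) = (q^j - 1) qbin s j.  The right-hand side is 0
    for j = 0 and then, by induction, for all j < s; the factor of qbin s (j+1) on
    the left is nonzero for j + 1 < s. *)
Lemma qbin_prim_root s j :
  s.-primitive_root q -> (0 < j < s)%N -> qbin s j = 0.
Proof.
move=> prim_q; case: j => [//|j] /andP[_]; elim: j => [|j IH] lt_js.
  have := qbin_step s 0; rewrite (prim_expr_order prim_q) expr0 subrr mul0r mul1r.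
  move/eqP; rewrite mulf_eq0 subr_eq0 eq_sym -(prim_order_dvd prim_q).
  by rewrite (gtnNdvd _ lt_js) //= => /eqP.
have := qbin_step s j.+1; rewrite IH ?(ltnW lt_js) // mulr0.
move/eqP; rewrite !mulf_eq0 subr_eq0 [1 == _]eq_sym -(prim_order_dvd prim_q).
rewrite (gtnNdvd _ lt_js) // orbF expf_eq0 (prim_root_eq0 prim_q).
by rewrite (gtn_eqF (prim_order_gt0 prim_q)) => /eqP.
Qed.

Lemma qbinomial (A : algType k) (x y : A) n : y * x = q *: (x * y) ->
  (x + y) ^+ n = \sum_(j < n.+1) qbin n j *: (x ^+ j * y ^+ (n - j)).
Proof.
move=> yx.
have yxj j : y * x ^+ j = q ^+ j *: (x ^+ j * y).
  elim: j => [|j IH]; first by rewrite !expr0 scale1r mulr1 mul1r.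
  rewrite !exprS mulrA yx -scalerAl -(mulrA x y) IH -scalerAr scalerA.
  by rewrite mulrA.
elim: n => [|n IH]; first by rewrite big_ord1 /= scale1r mulr1.
(* Multiplying by x shifts the index of summation, multiplying by y keeps it and
   brings out q^j: the two sums combine by the Pascal rule. *)
have xpart : \sum_(j < n.+1) x * (qbin n j *: (x ^+ j * y ^+ (n - j))) =
    \sum_(j < n.+2) (if j == 0%N :> nat then 0 else qbin n j.-1)
      *: (x ^+ j * y ^+ (n.+1 - j)).
  rewrite [RHS]big_ord_recl eqxx scale0r add0r; apply: eq_bigr => j _ /=.
  by rewrite -scalerAr mulrA -exprS.
have ypart : \sum_(j < n.+1) y * (qbin n j *: (x ^+ j * y ^+ (n - j))) =
    \sum_(j < n.+2) (q ^+ j * qbin n j) *: (x ^+ j * y ^+ (n.+1 - j)).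
  rewrite [RHS]big_ord_recr /= qbin_small // mulr0 scale0r addr0.
  apply: eq_bigr => j _; rewrite -scalerAr mulrA yxj -scalerAl scalerA.
  by rewrite -mulrA -exprS -subSn 1?mulrC // -ltnS.
rewrite exprS IH mulrDl !mulr_sumr xpart ypart -big_split /=.
apply: eq_bigr => -[[|j] ltj] _; rewrite -scalerDl //=.
by rewrite add0r !expr0 mul1r qbinn0.
Qed.

Lemma qbinomial_prim_root (A : algType k) (x y : A) s :
    s.-primitive_root q -> y * x = q *: (x * y) ->
  (x + y) ^+ s = x ^+ s + y ^+ s.
Proof.
move=> prim_q yx; rewrite (qbinomial _ yx).
case: s prim_q => [/prim_order_gt0 // | s] prim_q.
rewrite big_ord_recr big_ord_recl [qbin _ ord_max]qbinnn [qbin _ ord0]qbinn0.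
rewrite !scale1r subnn subn0 mulr1 mul1r big1 => [|j _].
  by rewrite /= addr0 addrC.
by rewrite qbin_prim_root ?scale0r //= /bump leq0n add1n ltnS ltn_ord.
Qed.
End QBinomial.

(** * Powers of x on modules, and morphisms out of the cyclic modules *)

Section Modules.
Variables (k : fieldType) (G : groupType) (chi : character G k).
Local Notation H := (hopf chi).

Lemma act_hxS (M : fdmod H) i (m : M) :
  act M (hx chi ^+ i.+1) m = act M (hx chi) (act M (hx chi ^+ i) m).
Proof. by rewrite exprS actM comp_lfunE. Qed.

Lemma act_hxD (M : fdmod H) i j (m : M) :
  act M (hx chi ^+ (i + j)) m = act M (hx chi ^+ i) (act M (hx chi ^+ j) m).
Proof. by rewrite exprD actM comp_lfunE. Qed.

Lemma act_hx0 (M : fdmod H) (m : M) : act M (hx chi ^+ 0) m = m.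
Proof. by rewrite act1 lfunE. Qed.

Lemma act_grp_hx (M : fdmod H) g i (m : M) :
  act M (hgrp chi g) (act M (hx chi ^+ i) m) =
  chi g ^+ i *: act M (hx chi ^+ i) (act M (hgrp chi g) m).
Proof.
rewrite -!comp_lfunE -!actM (qcomm_exp i (hx_grp chi g)) linearZ scale_lfunE.
by rewrite scalerA -exprMn mulfV ?char_neq0 // expr1n scale1r.
Qed.

Section Cyclic.
Variables (s : nat) (chi_s : char_order chi s).

Lemma Vmod_sum_vbase lambda gamma (v : Vmod chi_s lambda gamma) :
  v = \sum_(i < s) (v : 'rV[k]_s) 0 i *: (vbase k s i : Vmod chi_s lambda gamma).
Proof.
rewrite [LHS](row_sum_delta v); apply: eq_bigr => i _; congr (_ *: _).
by apply/rowP => j; rewrite !mxE.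
Qed.

Lemma Vmod_homP lambda gamma (U : vectType k)
    (F F' : 'Hom(Vmod chi_s lambda gamma, U)) :
  (forall i, (i < s)%N -> F (vbase k s i) = F' (vbase k s i)) -> F = F'.
Proof.
move=> E; apply/lfunP => v; rewrite [v]Vmod_sum_vbase !linear_sum.
by apply: eq_bigr => i _; rewrite !linearZ /= E.
Qed.

Lemma Vmod_linear_mem lambda gamma (X : vectType k) (U : {vspace X})
    (f : Vmod chi_s lambda gamma -> X) :
    linear f -> (forall i, (i < s)%N -> f (vbase k s i) \in U) ->
  forall v, f v \in U.
Proof.
move=> fl fU v.
pose F := HB.pack_for {linear Vmod chi_s lambda gamma -> X} f
  (GRing.isLinear.Build k _ _ _ f fl).
rewrite [v]Vmod_sum_vbase -[f _]/(F _) linear_sum; apply: rpred_sum => i _.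
by rewrite linearZ rpredZ //= fU.
Qed.

Lemma Vmod_hx_exp lambda gamma i : (i < s)%N ->
  act (Vmod chi_s lambda gamma) (hx chi ^+ i) (vbase k s 0) = vbase k s i.
Proof.
elim: i => [|i IH] lis; first by rewrite act_hx0.
by rewrite act_hxS IH ?(ltnW lis) // Vmod_x.
Qed.

(** On m_0 this is the closing relation of the cycle; since x^s commutes with x^i,
    it carries over to m_i = x^i m_0. *)
Lemma Vmod_hx_order lambda gamma v :
  act (Vmod chi_s lambda gamma) (hx chi ^+ s) v = gamma *: v.
Proof.
have s_gt0 : (0 < s)%N by case: chi_s.
have E0 : act (Vmod chi_s lambda gamma) (hx chi ^+ s) (vbase k s 0) =
    gamma *: vbase k s 0.
  have -> : hx chi ^+ s = hx chi ^+ s.-1.+1 by rewrite prednK.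
  by rewrite act_hxS Vmod_hx_exp ?prednK // Vmod_x_last.
suff -> : act (Vmod chi_s lambda gamma) (hx chi ^+ s) = gamma *: \1%VF.
  by rewrite scale_lfunE id_lfunE.
apply: Vmod_homP => i lis; rewrite scale_lfunE id_lfunE.
rewrite -(Vmod_hx_exp lambda gamma lis) -act_hxD addnC act_hxD E0.
by rewrite linearZ.
Qed.

(** On m_i the element g^s acts by chi(g)^(i s) lambda(g)^s, and chi^s = 1 makes
    this independent of i. *)
Lemma Vmod_grp_order lambda gamma g v :
  act (Vmod chi_s lambda gamma) (hgrp chi g ^+ s) v = lambda g ^+ s *: v.
Proof.
have [_ chi_s1 _] := chi_s.
suff -> : act (Vmod chi_s lambda gamma) (hgrp chi g ^+ s) =
   lambda g ^+ s *: \1%VF.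
  by rewrite scale_lfunE id_lfunE.
apply: Vmod_homP => i lis; rewrite scale_lfunE id_lfunE.
suff E n : act (Vmod chi_s lambda gamma) (hgrp chi g ^+ n) (vbase k s i) =
    (chi g ^+ i * lambda g) ^+ n *: vbase k s i.
  by rewrite E exprMn exprAC [chi g ^+ s]chi_s1 expr1n mul1r.
elim: n => [|n IH]; first by rewrite !expr0 scale1r act1 lfunE.
by rewrite exprS actM comp_lfunE IH linearZ /= Vmod_grp // scalerA -exprSr.
Qed.

Section Hom.
Variables (lambda : character G k) (gamma : k) (M : fdmod H) (w : M).

Definition Vmod_hom_fun (v : Vmod chi_s lambda gamma) : M :=
  \sum_(i < s) (v : 'rV[k]_s) 0 i *: act M (hx chi ^+ i) w.

Fact Vmod_hom_fun_linear : linear Vmod_hom_fun.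
Proof.
move=> c u v; rewrite /Vmod_hom_fun scaler_sumr -big_split; apply: eq_bigr => i _.
by rewrite !mxE scalerDl scalerA.
Qed.
HB.instance Definition _ := GRing.isLinear.Build k (Vmod chi_s lambda gamma) M
  *:%R Vmod_hom_fun Vmod_hom_fun_linear.

Definition Vmod_hom : 'Hom(Vmod chi_s lambda gamma, M) := linfun Vmod_hom_fun.

Lemma Vmod_hom_vbase i : (i < s)%N ->
  Vmod_hom (vbase k s i) = act M (hx chi ^+ i) w.
Proof.
move=> lis; rewrite lfunE /= /Vmod_hom_fun (bigD1 (Ordinal lis)) //= mxE eqxx.
rewrite scale1r big1 ?addr0 // => j; rewrite -val_eqE mxE /= => /negPf ->.
by rewrite scale0r.
Qed.

Hypothesis w_grp : forall g, act M (hgrp chi g) w = lambda g *: w.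
Hypothesis w_hx : act M (hx chi ^+ s) w = gamma *: w.

(** The universal property of V(lambda, gamma): it is generated by a vector of
    weight lambda on which x^s acts by gamma, and these relations define it. *)
Lemma Vmod_hom_act p v :
  Vmod_hom (act (Vmod chi_s lambda gamma) p v) = act M p (Vmod_hom v).
Proof.
apply: (hopf_hom_gen (f := Vmod_hom)) => [g u|u];
  rewrite -!comp_lfunE; congr (fun_of_lfun _ u);
  apply: Vmod_homP => i lis; rewrite !comp_lfunE.
  (* The weight of x^i w under g is chi(g)^i lambda(g), that of m_i. *)
  rewrite Vmod_grp // linearZ /= !Vmod_hom_vbase // act_grp_hx w_grp linearZ.
  by rewrite scalerA.
rewrite Vmod_hom_vbase // -act_hxS.
have [lis1|les] := ltnP i.+1 s; first by rewrite Vmod_x // Vmod_hom_vbase.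
have Es : i.+1 = s by apply/eqP; rewrite eqn_leq lis.
have -> : i = s.-1 by rewrite -Es.
rewrite Vmod_x_last linearZ /= Vmod_hom_vbase ?(leq_ltn_trans _ lis) //.
by rewrite act_hx0 prednK ?(leq_ltn_trans _ lis).
Qed.

End Hom.
End Cyclic.
End Modules.

(** * Morphisms out of a direct sum *)

Section DirectSum.
Variables (k : fieldType) (A : algType k).

Section Copair.
Variables (n : nat) (M : 'I_n -> fdmod A) (N : fdmod A).
Variable (h : forall t, 'Hom(M t, N)).

Definition dsum_hom_fun (v : dsum M) : N := \sum_t h t ((v : dsum_space M) t).

Fact dsum_hom_fun_linear : linear dsum_hom_fun.
Proof.
move=> c u v; rewrite /dsum_hom_fun scaler_sumr -big_split; apply: eq_bigr => i _.
by rewrite dsumDE dsumZE linearP.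
Qed.
HB.instance Definition _ := GRing.isLinear.Build k (dsum M) N
  *:%R dsum_hom_fun dsum_hom_fun_linear.

Definition dsum_hom : 'Hom(dsum M, N) := linfun dsum_hom_fun.

Lemma dsum_hom_act : (forall t p v, h t (act (M t) p v) = act N p (h t v)) ->
  forall p v, dsum_hom (act (dsum M) p v) = act N p (dsum_hom v).
Proof.
move=> hact p v; rewrite !lfunE /= /dsum_hom_fun linear_sum.
by apply: eq_bigr => t _; apply: etrans (hact t p _); rewrite ffunE.
Qed.

Lemma limg_dsum_hom t v : h t v \in limg dsum_hom.
Proof.
pose u : dsum M := finfun (dfwith (fun i => 0 : M i) v) : dsum_space M.
have -> : h t v = dsum_hom u.
  rewrite lfunE /= /dsum_hom_fun (bigD1 t) //= ffunE dfwith_in big1 ?addr0 //.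
  by move=> i ne_it; rewrite ffunE dfwith_out 1?eq_sym // linear0.
exact: memv_img (memvf u).
Qed.

Lemma dim_dsum : \dim {: dsum M} = (\sum_t \dim {: M t})%N.
Proof. by rewrite dimvf. Qed.

End Copair.

Lemma fdmod_iso_surj (M N : fdmod A) (F : 'Hom(N, M)) :
    (forall p v, F (act N p v) = act M p (F v)) ->
    limg F = fullv -> \dim {: N} = \dim {: M} ->
  fdmod_iso M N.
Proof.
move=> Fact Fsurj dimE.
have Fker : lker F == 0%VS.
  have := limg_ker_dim F fullv; rewrite Fsurj dimE => /eqP.
  by rewrite capfv -{2}[\dim {:M}]add0n eqn_add2r dimv_eq0.
have FK := lker0_lfunK Fker.
have FVK : cancel F^-1%VF F by move=> m; apply: limg_lfunVK; rewrite Fsurj memvf.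
exists F^-1%VF; first by exists F.
by move=> p m; rewrite -{1}(FVK m) -Fact FK.
Qed.

End DirectSum.

(** * Powers of x on tensor products *)

Lemma tens_eltX (k : fieldType) (B1 B2 : choiceType)
    (L1 : monlaw k B1) (L2 : monlaw k B2)
    (p : monalgebra L1) (r : monalgebra L2) n :
  tens_elt p r ^+ n = tens_elt (p ^+ n) (r ^+ n).
Proof.
elim: n => [|n IH]; first by rewrite !expr0 tens_elt1.
by rewrite !exprS IH tens_eltM.
Qed.

Section TensorProduct.
Variables (k : fieldType) (G : groupType) (chi : character G k).
Variables (a : G) (aZ : central a).
Local Notation q := (char_inv chi a).

Lemma tens_elt_qcomm :
  tens_elt (1 : hopf chi) (hx chi) * tens_elt (hx chi) (hgrp chi a) =
  q *: (tens_elt (hx chi) (hgrp chi a) * tens_elt 1 (hx chi)).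
Proof.
rewrite !tens_eltM mul1r mulr1 hx_grp.
by rewrite (linear_scale (tens_elt_linearr _)).
Qed.

Variables (V W : fdmod (hopf chi)).

Lemma hopf_tens_hxX n v w :
  act (hopf_tens aZ V W) (hx chi ^+ n) (tens_vec v w) =
  \sum_(j < n.+1) qbin q n j *:
    tens_vec (act V (hx chi ^+ j) v)
             (act W (hgrp chi a ^+ j * hx chi ^+ (n - j)) w).
Proof.
rewrite -[LHS]/(act (outer_tens V W) (comul chi aZ (hx chi ^+ n)) _).
rewrite rmorphXn /= comul_hx (qbinomial _ tens_elt_qcomm) linear_sum sum_lfunE.
apply: eq_bigr => j _; rewrite linearZ scale_lfunE !tens_eltX tens_eltM.
by rewrite expr1n mulr1 outer_tensE.
Qed.

Lemma hopf_tens_hx_order s v w : s.-primitive_root q ->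
  act (hopf_tens aZ V W) (hx chi ^+ s) (tens_vec v w) =
  tens_vec (act V (hx chi ^+ s) v) (act W (hgrp chi a ^+ s) w)
  + tens_vec v (act W (hx chi ^+ s) w).
Proof.
move=> prim_q.
rewrite -[LHS]/(act (outer_tens V W) (comul chi aZ (hx chi ^+ s)) _).
rewrite rmorphXn /= comul_hx (qbinomial_prim_root prim_q tens_elt_qcomm).
by rewrite linearD add_lfunE !tens_eltX !outer_tensE expr1n act1 id_lfunE.
Qed.

End TensorProduct.

(** * Generation of the tensor product by m_0 (x) W *)

Section Generation.
Variables (k : fieldType) (G : groupType) (chi : character G k).
Variables (a : G) (aZ : central a).
Variables (s : nat) (chi_s : char_order chi s).
Variables (sigma : character G k) (alpha : k) (W : fdmod (hopf chi)).
Local Notation V := (Vmod chi_s sigma alpha).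

Lemma act_grpX_surj (M : fdmod (hopf chi)) g i (m : M) :
  exists m', act M (hgrp chi g ^+ i) m' = m.
Proof.
exists (act M (hgrp chi g^-1%g ^+ i) m).
rewrite -comp_lfunE -actM -exprMn_comm; last first.
  by rewrite /GRing.comm -!hgrpM mulgV mulVg.
by rewrite -hgrpM mulgV hgrp1 expr1n act1 id_lfunE.
Qed.

(** In the q-binomial expansion of x^i (m_0 (x) w) the term of highest index in the
    first factor is m_i (x) a^i w; no index exceeds i < s, so x never wraps around
    in the first factor. *)
Lemma hopf_tens_generation (U : {vspace tens_space V W}) :
    (forall z, z \in U -> act (hopf_tens aZ V W) (hx chi) z \in U) ->
    (forall w : W, tens_vec (vbase k s 0 : V) w \in U) ->
  U = fullv.
Proof.
move=> U_hx U_0.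
have U_hxX i z : z \in U -> act (hopf_tens aZ V W) (hx chi ^+ i) z \in U.
  move=> Uz; elim: i => [|i IH]; first by rewrite act_hx0.
  by rewrite act_hxS U_hx.
have U_i i : (i < s)%N -> forall w : W, tens_vec (vbase k s i : V) w \in U.
  elim/ltn_ind: i => i IH lis w0; have [w <-] := act_grpX_surj a i w0.
  have := U_hxX i _ (U_0 w); rewrite hopf_tens_hxX big_ord_recr /=.
  rewrite qbinnn scale1r subnn expr0 mulr1 Vmod_hx_exp // rpredDl //.
  apply: rpred_sum => j _; have ltjs := ltn_trans (ltn_ord j) lis.
  by rewrite rpredZ // Vmod_hx_exp ?IH.
apply/vspaceP => z; rewrite memvf [z]tens_vec_gen; apply: rpred_sum => i _.
apply: rpred_sum => j _; rewrite rpredZ //.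
move: (_`_i) (_`_j) => v w.
apply: (Vmod_linear_mem (f := fun v : V => tens_vec v w)) => [|l lls].
  exact: tens_vec_linearl.
exact: U_i.
Qed.

End Generation.

(** * The decomposition *)

Theorem proposition3p18 (k : fieldType) (G : groupType) (chi : character G k)
    (a : G) (aZ : central a) (chi_a : chi a != 1)
    (s : nat) (chi_s : char_order chi s)
    (prim_s : s.-primitive_root (char_inv chi a))
    (sigma lambda : character G k) (alpha beta : k) :
  fdmod_iso
    (hopf_tens aZ (Vmod chi_s sigma alpha) (Vmod chi_s lambda beta))
    (dsum (fun t : 'I_s =>
      Vmod chi_s (char_mul (char_mul (char_exp chi t) sigma) lambda)
        (alpha * lambda a ^+ s + beta))).
Proof.
set V := Vmod chi_s sigma alpha; set W := Vmod chi_s lambda beta.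
set gamma := alpha * _ + beta; set M := hopf_tens aZ V W.
pose w t : M := tens_vec (vbase k s 0 : V) (vbase k s t : W).
pose N (t : 'I_s) :=
  Vmod chi_s (char_mul (char_mul (char_exp chi t) sigma) lambda) gamma.
have [s_gt0 _ _] := chi_s.
have w_grp t g : (t < s)%N -> act M (hgrp chi g) (w t) =
    char_mul (char_mul (char_exp chi t) sigma) lambda g *: w t.
  move=> lts; rewrite hopf_tens_grp !Vmod_grp // expr0 mul1r.
  rewrite (linear_scale (tens_vec_linearl _)) (linear_scale (tens_vec_linearr _)).
  by rewrite scalerA /=; congr (_ *: _); ring.
have w_hx t : act M (hx chi ^+ s) (w t) = gamma *: w t.
  rewrite (hopf_tens_hx_order _ _ _ prim_s) !Vmod_hx_order Vmod_grp_order.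
  rewrite (linear_scale (tens_vec_linearl _)) !(linear_scale (tens_vec_linearr _)).
  by rewrite scalerA -scalerDl.
pose h (t : 'I_s) : 'Hom(N t, M) := Vmod_hom chi_s _ gamma (w t).
have h_act t p v : h t (act (N t) p v) = act M p (h t v).
  by apply: Vmod_hom_act => [g|]; [apply: w_grp | apply: w_hx].
apply: (@fdmod_iso_surj _ _ M (dsum N) (dsum_hom h)).
- exact: dsum_hom_act.
- apply: (hopf_tens_generation (aZ := aZ)) => [z /memv_imgP[u _ ->] | w0].
    by rewrite -(dsum_hom_act h_act) memv_img ?memvf.
  apply: (Vmod_linear_mem (f := fun w : W => tens_vec (vbase k s 0 : V) w)).
    exact: tens_vec_linearr.
  move=> t lts; have := limg_dsum_hom h (vbase k s 0 : N (Ordinal lts)).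
  by rewrite Vmod_hom_vbase // act_hx0.
rewrite dim_dsum (eq_bigr (fun=> s)) => [|t _]; last by rewrite dimvf /dim /= mul1n.
rewrite sum_nat_const card_ord [RHS]dimvf /dim /=.
by rewrite !dimvf /dim /= !mul1n.
Qed.
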